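(* Let $1\le k\le n$, let $\mathcal S\subset\mathcal P_n$ be the stabilizer group of a stabilizer code with logical Pauli group $\mathcal L$, $D$ a decoding map, and $\tilde G\subset\tilde{\mathcal P}_n$ a subgroup with $|\tilde G|>1$. Assume $p_{\rm QEC}=0$ and $p_{\rm DD}\in[0,1)$. Let $\alpha$ be the minimal weight of an uncorrectable error, i.e. of an element of $\tilde{\mathcal P}_n\setminus K$, and let $\beta\ge\alpha$ be the minimal weight of a suppressed uncorrectable error, i.e. of an element of $(\tilde{\mathcal P}_n\setminus\tilde G^\perp)\setminus K$. Then: 1. If $\beta=\alpha$, then there exists $p_0>0$ such that $F_{\rm Hyb}>F_{\rm QEC}$ for all $p\in(0,p_0)$. 2. Suppose $\beta>\alpha$ and there exists an uncorrectable error $E'$ of weight $\alpha$ with $\mathrm{syn}(E')\ne0$. Fix a decomposition $\tilde G=\{\pi(I),g\}\tilde G_1$ with $g\in\tilde G$ and $\tilde G_1\subsetneq\tilde G$ a subgroup (such a decomposition always exists). Then there exists $S\in\pi(\mathcal S)$ such that for $\tilde G'=\{\pi(I),gS\}\tilde G_1$ the corresponding minimal weight $\beta'$ of an element of $(\tilde{\mathcal P}_n\setminus\tilde G'^{\perp})\setminus K$ satisfies $\beta'=\alpha$. In particular, $\tilde G'$ satisfies the condition of part 1. 3. Suppose the code distance $d$ is at least $2$. Then $\alpha\le\lceil d/2\rceil<d$, and $\mathrm{syn}(E')\ne0$ for every uncorrectable error $E'$ of weight $\alpha$. 4. Suppose $\beta>\alpha$ and $\tilde G=\pi(\mathcal L)$.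 Then $\mathrm{syn}(E')\neq0$ for every uncorrectable error $E'$ of weight $\alpha$.
   Context: Paulis. $\mathcal P_n$ is the $n$-qubit Pauli group (with phases $\pm1,\pm i$), $\tilde{\mathcal P}_n=\mathcal P_n/\langle iI\rangle$, and $\pi:\mathcal P_n\to\tilde{\mathcal P}_n$ is the projection. Elements of $\tilde{\mathcal P}_n$ are represented by strings in $\{I,X,Y,Z\}^n$; the weight $\mathrm{wt}(E')$ is the number of non-identity letters. Two elements of $\tilde{\mathcal P}_n$ are said to commute (anticommute) if their representatives in $\mathcal P_n$ do. Code. $\mathcal S\subset\mathcal P_n$ is a subgroup with $2^{n-k}$ elements not containing $-I$. $C(\mathcal S)$ is its centralizer in $\mathcal P_n$. $\mathcal L\subseteq C(\mathcal S)$ is a subgroup with $C(\mathcal S)=\mathcal S\mathcal L$ and $\pi(\mathcal S)\cap\pi(\mathcal L)=\{\pi(I)\}$. The distance $d$ is the minimum weight of an element of $\pi(\mathcal S\mathcal L)\setminus\pi(\mathcal S)$. $\mathcal S^*$ is the $\mathbb F_2$-dual of $\mathcal S$; the syndrome $\mathrm{syn}(E')\in\mathcal S^*$ is given by $\mathrm{syn}(E')(s)=1$ iff $E'$ anticommutes with $s$. A decoding map is a map $D:\mathcal S^*\to\tilde{\mathcal P}_n$ with $D(0)=\pi(I)$ and $\mathrm{syn}(D(\sigma))=\sigma$ for all $\sigma$. Sets. $K=\{E'\in\tilde{\mathcal P}_n: D(\mathrm{syn}(E'))E'\in\pi(\mathcal S)\}$ is the set of correctable errors; elements of $\tilde{\mathcal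 P}_n\setminus K$ are uncorrectable. For a subgroup $\tilde H\subset\tilde{\mathcal P}_n$, $\tilde H^\perp$ is the set of $E'\in\tilde{\mathcal P}_n$ commuting with every element of $\tilde H$. Errors in $\tilde{\mathcal P}_n\setminus\tilde G^\perp$ are called suppressed. Hybrid LDD+QEC protocol. For $p\in(0,1)$, a random error $E'\in\tilde{\mathcal P}_n$ is drawn from the distribution obtained from $(1-p)^{n-\mathrm{wt}(E')}(p/3)^{\mathrm{wt}(E')}$ by multiplying the probabilities of all suppressed $E'$ by $p_{\rm DD}$ and renormalizing. The syndrome $\sigma=\mathrm{syn}(E')$ is measured. If $\sigma=0$, the recovery is $R=\pi(I)$. If $\sigma\ne0$, then with probability $1-p_{\rm QEC}$ the recovery is $R=D(\sigma)$, and with probability $p_{\rm QEC}$ it is a uniformly random $R\in\tilde{\mathcal P}_n$ with $\mathrm{syn}(R)=\sigma$. $F_{\rm Hyb}$ is the probability that $RE'\in\pi(\mathcal S)$ (no logical error). The QEC-only protocol is the same with no rescaling, i.e. with $p_{\rm DD}$ replaced by $1$, and $F_{\rm QEC}$ is its fidelity. *)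

(* Defs.v *)
From HB Require Import structures.
From mathcomp Require Import all_boot all_order all_algebra all_fingroup.
From mathcomp Require Import algC.
From mathcomp Require Import reals.

Set Implicit Arguments.
Unset Strict Implicit.
Unset Printing Implicit Defensive.

Import Order.TTheory GRing.Theory Num.Theory.

Local Open Scope ring_scope.

Inductive letter := pI | pX | pY | pZ.

Definition letter_code (a : letter) : bool * bool :=
  match a with
  | pI => (false, false) | pX => (true, false)
  | pY => (true, true) | pZ => (false, true)
  end.
Definition letter_decode (b : bool * bool) : letter :=
  match b with
  | (false, false) => pI | (true, false) => pX
  | (true, true) => pY | (false, true) => pZ
  end.
Fact letter_codeK : cancel letter_code letter_decode. Proof. by case. Qed.
HB.instance Definition _ := Finite.copy letter (can_type letter_codeK).

(* The product of two letters a, b is i ^ (lphase a b) times lmul a b: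
   XY = iZ, YZ = iX, ZX = iY, and X, Y, Z square to I. *)
Definition lmul (a b : letter) : letter :=
  match a, b with
  | pI, c | c, pI => c
  | pX, pX | pY, pY | pZ, pZ => pI
  | pX, pY | pY, pX => pZ
  | pY, pZ | pZ, pY => pX
  | pZ, pX | pX, pZ => pY
  end.
Definition lphase (a b : letter) : 'Z_4 :=
  match a, b with
  | pX, pY | pY, pZ | pZ, pX => 1
  | pY, pX | pZ, pY | pX, pZ => -1
  | _, _ => 0
  end.

(* Pauli a w is the operator i ^ a * (w 0 (x) ... (x) w (n - 1)). *)
Record pauli (n : nat) := Pauli {
  phase : 'Z_4;
  letters : {ffun 'I_n -> letter}
}.

Section PauliGroup.
Variable n : nat.
Implicit Types P Q : pauli n.

Definition pauli_pair P := (phase P, letters P).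
Definition pair_pauli (x : 'Z_4 * {ffun 'I_n -> letter}) : pauli n :=
  Pauli x.1 x.2.
Fact pauli_pairK : cancel pauli_pair pair_pauli. Proof. by case. Qed.
HB.instance Definition _ := Finite.copy (pauli n) (can_type pauli_pairK).

Definition pauli_one : pauli n := Pauli 0 [ffun => pI].
Definition pauli_mul P Q : pauli n :=
  Pauli (phase P + phase Q + \sum_(j < n) lphase (letters P j) (letters Q j))
        [ffun j => lmul (letters P j) (letters Q j)].
Definition pauli_inv P : pauli n := Pauli (- phase P) (letters P).

Fact pauli_mulA : associative pauli_mul.
Proof.
move=> P Q T; congr Pauli; last first.
  by apply/ffunP=> j; rewrite !ffunE; do 3!case: (letters _ j).
rewrite /= -!addrA; congr (_ + (_ + _)); rewrite [RHS]addrCA; congr (_ + _).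
rewrite -!big_split /=.
apply: eq_bigr => j _; rewrite !ffunE.
by do 3!case: (letters _ j); apply/eqP.
Qed.

Fact pauli_mul1g : left_id pauli_one pauli_mul.
Proof.
case=> a w; congr Pauli; last by apply/ffunP=> j; rewrite !ffunE.
by rewrite /= add0r big1 ?addr0 // => j _; rewrite ffunE.
Qed.

Fact pauli_mulg1 : right_id pauli_one pauli_mul.
Proof.
case=> a w; congr Pauli; last by apply/ffunP=> j; rewrite !ffunE; case: (w j).
by rewrite /= addr0 big1 ?addr0 // => j _; rewrite ffunE; case: (w j).
Qed.

Fact pauli_mulVg : left_inverse pauli_one pauli_inv pauli_mul.
Proof.
case=> a w; congr Pauli; last by apply/ffunP=> j; rewrite !ffunE; case: (w j).
by rewrite /= addNr add0r big1 // => j _; case: (w j).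
Qed.

Fact pauli_mulgV : right_inverse pauli_one pauli_inv pauli_mul.
Proof.
case=> a w; congr Pauli; last by apply/ffunP=> j; rewrite !ffunE; case: (w j).
by rewrite /= addrN add0r big1 // => j _; case: (w j).
Qed.

HB.instance Definition _ := isGroup.Build (pauli n)
  pauli_mulA pauli_mul1g pauli_mulg1 pauli_mulVg pauli_mulgV.

Lemma phaseM P Q : phase (P * Q)%g =
  phase P + phase Q + \sum_(j < n) lphase (letters P j) (letters Q j).
Proof. by []. Qed.

Lemma lettersM P Q j :
  letters (P * Q)%g j = lmul (letters P j) (letters Q j).
Proof. by rewrite ffunE. Qed.

End PauliGroup.


(* The group law above is that of the Pauli matrices: pauli_entry P b c is the
   entry of the 2 ^ n x 2 ^ n matrix of P at row b and column c. *)
Definition letter_mx (a : letter) : 'M[algC]_2 :=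
  \matrix_(i, j)
    match a with
    | pI => (i == j)%:R
    | pX => (i != j)%:R
    | pY => if i == j then 0 else if i == 0 then - 'i else 'i
    | pZ => if i != j then 0 else if i == 0 then 1 else -1
    end.

Definition pauli_entry n (P : pauli n) (b c : {ffun 'I_n -> 'I_2}) : algC :=
  'i ^+ phase P * \prod_(j < n) letter_mx (letters P j) (b j) (c j).

Lemma iexp_add (a b : 'Z_4) : ('i : algC) ^+ (a + b)%R = 'i ^+ a * 'i ^+ b.
Proof.
have i4 : ('i : algC) ^+ 4 = 1 by rewrite (exprM 'i 2 2) sqrCi sqrrN expr1n.
by rewrite -exprD /= -[in RHS](expr_mod _ i4).
Qed.

Lemma letter_mxM a b :
  letter_mx a *m letter_mx b = 'i ^+ lphase a b *: letter_mx (lmul a b).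
Proof.
have E3 : ('i : algC) ^+ 3 = - 'i by rewrite exprS sqrCi mulrN1.
have E2 : 'i * 'i = -1 :> algC by rewrite -expr2 sqrCi.
apply/matrixP=> i j; rewrite !mxE !big_ord_recl big_ord0 !mxE addr0 -!val_eqE /=.
case: i => [[|[|//]] hi]; case: j => [[|[|//]] hj] /=;
case: a; case: b => /=; rewrite ?expr0 ?expr1 ?E3;
rewrite ?(mul0r, mulr0, add0r, addr0, mul1r, mulr1, mulN1r, mulrN1, mulrN, mulNr, opprK, E2) //.
Qed.

Lemma pauli_entryM n (P Q : pauli n) b c :
  pauli_entry (P * Q)%g b c =
  \sum_(e : {ffun 'I_n -> 'I_2}) pauli_entry P b e * pauli_entry Q e c.
Proof.
rewrite /pauli_entry phaseM.
pose f j (e : 'I_2) :=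
  letter_mx (letters P j) (b j) e * letter_mx (letters Q j) e (c j).
transitivity ('i ^+ phase P * 'i ^+ phase Q *
              \sum_(e : {ffun 'I_n -> 'I_2}) \prod_j f j (e j)); last first.
  rewrite mulr_sumr; apply: eq_bigr => e _; rewrite /f big_split /=.
  by rewrite mulrACA.
rewrite -(bigA_distr_bigA f) !iexp_add -!mulrA; congr (_ * (_ * _)).
rewrite (big_morph (fun a : 'Z_4 => 'i ^+ a : algC) iexp_add
  (expr0 'i : 'i ^+ (0%R : 'Z_4) = 1 :> algC)).
rewrite -big_split /=; apply: eq_bigr => j _.
have /matrixP/(_ (b j) (c j)) := letter_mxM (letters P j) (letters Q j).
by rewrite lettersM !mxE => <-.
Qed.

Section Projection.
Variable n : nat.
Implicit Types P Q T : pauli n.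

Definition scalarI (a : 'Z_4) : pauli n := Pauli a [ffun => pI].
Definition iI : pauli n := scalarI 1.
Definition minusI : pauli n := scalarI 2.

Definition commutes P Q : bool := (P * Q == Q * P)%g.
Definition anticommutes P Q : bool := (P * Q == minusI * (Q * P))%g.

Definition phases : {group pauli n} := <[iI]>%G.

(* The projective Pauli group, with projection coset phases. *)
Local Notation ppauli := (coset_of phases).

Implicit Types E F : ppauli.

(* Letters and commutation of a class are read off its library-chosen
   representative; wt_coset, pcommutes_coset and syn_coset below show that the
   choice is irrelevant. *)
Definition wt E : nat := #|[set j | letters (repr E) j != pI]|.
Definition pcommutes E F : bool := commutes (repr E) (repr F).

Definition comm_sign P Q : 'Z_4 :=
  \sum_(j < n) (lphase (letters P j) (letters Q j)
                - lphase (letters Q j) (letters P j)).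

Lemma scalarIM a P : (scalarI a * P)%g = Pauli (a + phase P) (letters P).
Proof.
congr Pauli; last by apply/ffunP=> j; rewrite !ffunE.
by rewrite /= big1 ?addr0 // => j _; rewrite ffunE.
Qed.

Lemma mulg_scalarI a P : (P * scalarI a)%g = (scalarI a * P)%g.
Proof.
rewrite scalarIM; congr Pauli.
  rewrite /= big1; first by rewrite addr0 addrC.
  by move=> j _; rewrite ffunE; case: (letters _ _).
by apply/ffunP=> j; rewrite !ffunE; case: (letters _ _).
Qed.

Lemma mulg_comm_sign P Q : (P * Q)%g = (scalarI (comm_sign P Q) * (Q * P))%g.
Proof.
rewrite scalarIM; congr Pauli.
  rewrite phaseM /comm_sign big_split /= sumrN.
  rewrite [X in _ = _ + X]addrC addrA subrK addrC [phase P + _]addrC.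
  by [].
by apply/ffunP=> j; rewrite !ffunE; do 2!case: (letters _ _).
Qed.

Lemma scalarI_inj P : injective (fun a => scalarI a * P)%g.
Proof.
move=> a b; rewrite !scalarIM => /(congr1 (@phase n)) e.
exact: (@addIr _ (phase P) a b e).
Qed.

Lemma commutesE P Q : commutes P Q = (comm_sign P Q == 0).
Proof.
rewrite /commutes {1}mulg_comm_sign.
rewrite -{2}[(Q * P)%g]mul1g -[1%g]/(scalarI 0).
by rewrite (inj_eq (@scalarI_inj _)).
Qed.

Lemma anticommutesE P Q : anticommutes P Q = (comm_sign P Q == 2).
Proof.
by rewrite /anticommutes {1}mulg_comm_sign (inj_eq (@scalarI_inj _)).
Qed.

Lemma comm_sign_or P Q : comm_sign P Q = 0 \/ comm_sign P Q = 2.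
Proof.
apply: (big_ind (fun a : 'Z_4 => a = 0 \/ a = 2)); first by left.
  move=> a b [->|->] [->|->]; rewrite ?addr0 ?add0r; auto.
  by left; apply/eqP.
by move=> j _; do 2!case: (letters _ _); first [by left; apply/eqP | by right; apply/eqP].
Qed.

Lemma anticommutesNE P Q : anticommutes P Q = ~~ commutes P Q.
Proof. by rewrite anticommutesE commutesE; case: (comm_sign_or P Q) => ->. Qed.

Lemma comm_signM P Q T : comm_sign P (Q * T)%g = comm_sign P Q + comm_sign P T.
Proof.
rewrite /comm_sign -big_split; apply: eq_bigr => j _; rewrite lettersM.
by apply/eqP; do 3!case: (letters _ _).
Qed.

Lemma anticommutesMr P Q T :
  anticommutes P (Q * T)%g = anticommutes P Q (+) anticommutes P T.
Proof.
rewrite !anticommutesE comm_signM.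
by case: (comm_sign_or P Q) (comm_sign_or P T) => -> [] ->.
Qed.

Lemma phasesP P : reflect (letters P = [ffun => pI]) (P \in phases).
Proof.
have iIX m : (iI ^+ m)%g = scalarI m%:R.
  elim: m => [|m IHm]; first by [].
  by rewrite expgS IHm scalarIM /= -mulrS.
apply: (iffP (cycleP iI P)) => [[m ->]|PI]; first by rewrite iIX.
exists (phase P : nat); rewrite iIX /scalarI -PI natr_Zp.
by case: P {PI}.
Qed.

Lemma repr_coset P : exists a, repr (coset phases P) = (scalarI a * P)%g.
Proof.
have nP : P \in 'N(phases)%g.
  apply: (subsetP (cent_sub _)); rewrite cent_cycle; apply/cent1P.
  exact: mulg_scalarI.
have := mem_repr_coset (coset phases P); rewrite val_coset //.
case/rcosetP=> z /phasesP zI ->; exists (phase z); rewrite /scalarI -zI.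
by case: z {zI}.
Qed.

Lemma letters_repr_coset P : letters (repr (coset phases P)) = letters P.
Proof. by have [a ->] := repr_coset P; rewrite scalarIM. Qed.

Lemma wt_coset P : wt (coset phases P) = #|[set j | letters P j != pI]|.
Proof. by rewrite /wt letters_repr_coset. Qed.

Lemma comm_sign_coset P Q :
  comm_sign (repr (coset phases P)) (repr (coset phases Q)) = comm_sign P Q.
Proof. by rewrite /comm_sign !letters_repr_coset. Qed.

Lemma pcommutes_coset P Q :
  pcommutes (coset phases P) (coset phases Q) = commutes P Q.
Proof. by rewrite /pcommutes !commutesE comm_sign_coset. Qed.

Lemma anticommutes_repr P Q :
  anticommutes (repr (coset phases P)) Q = anticommutes P Q.
Proof. by rewrite !anticommutesE /comm_sign letters_repr_coset. Qed.

(* All weights are at most n, so n.+1 stands for the minimum over the empty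
   set. *)
Definition min_wt (A : {set ppauli}) : nat := \big[minn/n.+1]_(E in A) wt E.

Lemma wt_le E : (wt E <= n)%N.
Proof. by rewrite -[n in leqRHS]card_ord max_card. Qed.

Lemma min_wt_le (A : {set ppauli}) E : E \in A -> (min_wt A <= wt E)%N.
Proof. by move=> AE; rewrite /min_wt -minEnat -leEnat; apply: bigmin_le_cond. Qed.

Lemma min_wt_attained (A : {set ppauli}) :
  A != set0 -> exists2 E, E \in A & wt E = min_wt A.
Proof.
case/set0Pn=> E0 AE0.
suff: (min_wt A = n.+1) \/ exists2 E, E \in A & wt E = min_wt A.
  by case=> // A0; have := min_wt_le AE0; rewrite A0 ltnNge wt_le.
apply: (big_ind (fun m => m = n.+1 \/ exists2 E, E \in A & wt E = m)).
- by left.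
- by move=> x y hx hy; case: (leqP x y).
- by move=> E AE; right; exists E.
Qed.

Definition perp (H : {set ppauli}) : {set ppauli} :=
  [set E | [forall F in H, pcommutes E F]].

Definition suppressed (G : {set ppauli}) : {set ppauli} := ~: perp G.

End Projection.

Notation ppauli n := (coset_of (phases n)).

Section StabilizerCode.
Variable n : nat.
Implicit Types (S L : {group pauli n}) (E : ppauli n).

Definition stabilizer_code (k : nat) S : Prop :=
  #|S| = (2 ^ (n - k))%N /\ minusI n \notin S.

Definition logical_group S L : Prop :=
  [/\ L \subset 'C(S)%g,
      'C(S)%g = (S * L)%g :> {set pauli n} &
      ((S / phases n) :&: (L / phases n))%g = 1%g :> {set ppauli n}].

Definition distance S L : nat :=
  min_wt (((S * L) / phases n) :\: (S / phases n))%g.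

Definition is_dual S (f : {ffun [subg S] -> 'F_2}) : bool :=
  [forall s, forall t, f (s * t)%g == f s + f t].

(* The F_2-dual S^* of S: the group homomorphisms from S to F_2. *)
Record sdual S := SDual {
  sdual_val :> {ffun [subg S] -> 'F_2};
  sdual_valP : is_dual sdual_val
}.
HB.instance Definition _ S := [isSub for @sdual_val S].
HB.instance Definition _ S := [Finite of sdual S by <:].

Fact is_dual0 S : @is_dual S [ffun => 0].
Proof. by apply/forallP=> s; apply/forallP=> t; rewrite !ffunE addr0. Qed.
Definition sdual0 S : sdual S := SDual (is_dual0 S).

Fact is_dual_syn S E :
  @is_dual S [ffun s : [subg S] => (anticommutes (repr E) (sgval s))%:R].
Proof.
apply/forallP=> s; apply/forallP=> t; rewrite !ffunE anticommutesMr.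
by do 2!case: (anticommutes _ _); apply/eqP/val_inj.
Qed.
Definition syn S E : sdual S := SDual (is_dual_syn S E).

Lemma syn_coset S (P : pauli n) (s : [subg S]) :
  syn S (coset (phases n) P) s = (anticommutes P (sgval s))%:R.
Proof. by rewrite /= ffunE anticommutes_repr. Qed.

Definition decoding_map S (D : sdual S -> ppauli n) : Prop :=
  D (sdual0 S) = 1%g /\ forall sigma, syn S (D sigma) = sigma.

Definition correctable S (D : sdual S -> ppauli n) : {set ppauli n} :=
  [set E | (D (syn S E) * E)%g \in (S / phases n)%g].

End StabilizerCode.

Section Protocol.
Variables (R : realType) (n : nat) (S : {group pauli n}).
Variables (D : sdual S -> ppauli n) (G : {group ppauli n}).
Variables (p pDD pQEC : R).
Implicit Types E Q : ppauli n.

Definition depol E : R := (1 - p) ^+ (n - wt E) * (p / 3%:R) ^+ wt E.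

Definition ldd_weight E : R :=
  (if E \in suppressed G then pDD else 1) * depol E.

Definition error_prob E : R := ldd_weight E / \sum_F ldd_weight F.

Definition recovery_prob (sigma : sdual S) Q : R :=
  if sigma == sdual0 S then (Q == 1%g)%:R
  else (1 - pQEC) * (Q == D sigma)%:R
       + pQEC * ((syn S Q == sigma)%:R / #|[set Q' | syn S Q' == sigma]|%:R).

(* The probability that the recovery Q and the error E satisfy Q E \in pi(S). *)
Definition F_hyb : R :=
  \sum_E error_prob E *
    \sum_(Q | (Q * E)%g \in (S / phases n)%g) recovery_prob (syn S E) Q.

End Protocol.

Definition F_qec (R : realType) n (S : {group pauli n}) D G (p pQEC : R) : R :=
  @F_hyb R n S D G p 1 pQEC.

(* Main.v *)
(** The projective Pauli group V is an elementary abelian 2-group on which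
    commutation is a nondegenerate bilinear form, so |H| |H^perp| = |V| and
    H^perp^perp = H for every subgroup H. Zero-syndrome errors form
    pi(S)^perp = pi(SL), which is strictly larger than pi(S) as k >= 1; hence
    uncorrectable errors exist.
    Part 1: cross-multiplying, F_Hyb > F_QEC reduces to b c < a e, where a, b
    (resp. c, e) are the unsuppressed and suppressed correctable (resp.
    uncorrectable) masses. Since a contains the identity and e an error of
    weight alpha, while b only has errors of positive weight and c of weight at
    least alpha, b c = O(p) a e as p -> 0.
    Part 2: an uncorrectable E' of weight alpha < beta commutes with all of G, so
    if s in S anticommutes with E' then so does g pi(s).
    Part 3: cut a logical operator of weight d into two halves; they have the
    same syndrome and their product is not a stabilizer, so one of them is
    uncorrectable.
    Part 4: an unsuppressed error of zero syndrome commutes with both pi(S) and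
    pi(L), hence lies in pi(SL)^perp = pi(S). *)

Require Import Defs.
From HB Require Import structures.
From mathcomp Require Import all_boot all_order all_algebra all_fingroup.
From mathcomp Require Import reals.
From mathcomp Require Import zify ring lra.

Set Implicit Arguments.
Unset Strict Implicit.
Unset Printing Implicit Defensive.

Import Order.TTheory GRing.Theory Num.Theory.
Local Open Scope ring_scope.

(** * The commutation form on the projective Pauli group *)

Section ProjectivePauli.
Variable n : nat.
Implicit Types (P Q : pauli n) (E F T : ppauli n) (H : {group ppauli n}).

Lemma phases_norm P : P \in 'N(phases n)%g.
Proof.
apply: (subsetP (cent_sub _)); rewrite cent_cycle; apply/cent1P.
exact: mulg_scalarI.
Qed.

Lemma cosetM P Q :
  coset (phases n) (P * Q)%g = (coset (phases n) P * coset (phases n) Q)%g.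
Proof. by rewrite morphM ?phases_norm. Qed.

Lemma mem_coset_quotient (A : {set pauli n}) P :
  P \in A -> coset (phases n) P \in (A / phases n)%g.
Proof. by move=> AP; rewrite mem_morphim ?phases_norm. Qed.

Lemma quotient_repr (A : {set pauli n}) E :
  E \in (A / phases n)%g -> exists2 P, P \in A & E = coset (phases n) P.
Proof. by case/morphimP=> P _ AP ->; exists P. Qed.

(** Equal letters leave only a scalar phase, which the quotient kills. Identities between classes
    can therefore be checked letter by letter. *)
Lemma letters_repr_inj E F :
  letters (repr E) = letters (repr F) -> E = F.
Proof.
move=> eEF; rewrite -[E]coset_reprK -[F]coset_reprK.
have -> : repr E = (scalarI n (phase (repr E) - phase (repr F)) * repr F)%g.
  by rewrite scalarIM subrK -eEF; case: (repr E).
by rewrite cosetM coset_id ?mul1g //; apply/phasesP.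
Qed.

Lemma letters_reprM E F j :
  letters (repr (E * F)%g) j = lmul (letters (repr E) j) (letters (repr F) j).
Proof.
by rewrite -{1}[E]coset_reprK -{1}[F]coset_reprK -cosetM letters_repr_coset lettersM.
Qed.

Lemma letters_repr1 : letters (repr (1%g : ppauli n)) = [ffun => pI].
Proof. by rewrite -(morph1 (coset (phases n))) letters_repr_coset. Qed.

Lemma ppauliC E F : (E * F = F * E)%g.
Proof.
apply: letters_repr_inj; apply/ffunP=> j; rewrite !letters_reprM.
by do 2!case: (letters _ _).
Qed.

Lemma ppauli_sq E : (E * E = 1)%g.
Proof.
apply: letters_repr_inj; apply/ffunP=> j; rewrite letters_reprM letters_repr1 ffunE.
by case: (letters _ _).
Qed.

Lemma wt1 : wt (1%g : ppauli n) = 0%N.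
Proof.
by rewrite /wt letters_repr1; apply: eq_card0 => j; rewrite !inE ffunE.
Qed.

Lemma wt_gt0 E : E != 1%g -> (0 < wt E)%N.
Proof.
apply: contraNT; rewrite -eqn0Ngt cards_eq0 => /eqP w0.
apply/eqP/letters_repr_inj; rewrite letters_repr1; apply/ffunP=> j.
by have := in_set0 j; rewrite -w0 inE ffunE => /negbFE/eqP.
Qed.

Lemma pcommutesC E F : pcommutes E F = pcommutes F E.
Proof. by rewrite /pcommutes /commutes eq_sym. Qed.

(** Anticommutation is the F_2-valued form, with [(+)] as addition; this is its additivity. *)
Lemma pcommutesMr E F T :
  ~~ pcommutes E (F * T)%g = ~~ pcommutes E F (+) ~~ pcommutes E T.
Proof.
rewrite -{1}[E]coset_reprK -{1}[F]coset_reprK -{1}[T]coset_reprK -cosetM.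
by rewrite pcommutes_coset -anticommutesNE anticommutesMr !anticommutesNE.
Qed.

Lemma pcommutesMl E F T :
  ~~ pcommutes (E * F)%g T = ~~ pcommutes E T (+) ~~ pcommutes F T.
Proof. by rewrite !(pcommutesC _ T) pcommutesMr. Qed.

Lemma pcommutes1 E : pcommutes E 1%g.
Proof. by have := pcommutesMr E 1 1; rewrite mulg1 addbb => /negbFE. Qed.

(** Test against X and Z placed at a single position: only the letter I commutes with both. *)
Lemma pcommutes_nondegenerate E : (forall F, pcommutes E F) -> E = 1%g.
Proof.
move=> cE; apply: letters_repr_inj; rewrite letters_repr1; apply/ffunP=> j.
rewrite ffunE; apply/eqP; case: (boolP (_ == _)) => // Ej.
pose single a := coset (phases n) (Pauli 0 [ffun i => if i == j then a else pI]).
have sE a : commutes (repr E) (Pauli 0 [ffun i => if i == j then a else pI]).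
  by have := cE (single a); rewrite -{1}[E]coset_reprK pcommutes_coset.
have sgn a : lphase (letters (repr E) j) a - lphase a (letters (repr E) j) = 0.
  have := sE a; rewrite commutesE /comm_sign (bigD1 j) //= ffunE eqxx big1 => [|i /negPf ij].
    by rewrite addr0 => /eqP.
  by rewrite ffunE ij; case: (letters _ _); rewrite /= subrr.
by move: Ej (sgn pX) (sgn pZ); case: (letters _ _) => // _ /eqP + /eqP.
Qed.

(** * Orthogonal complements and their orders *)

Lemma perpP (A : {set ppauli n}) E :
  reflect (forall F, F \in A -> pcommutes E F) (E \in perp A).
Proof. by rewrite inE; apply: (iffP forall_inP). Qed.

Lemma perp_group_set (A : {set ppauli n}) : group_set (perp A).
Proof.
apply/group_setP; split=> [|E F /perpP AE /perpP AF]; apply/perpP=> T AT.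
  by rewrite pcommutesC pcommutes1.
by have := pcommutesMl E F T; rewrite AE // AF // => /negbFE.
Qed.
Canonical perp_group (A : {set ppauli n}) := Group (perp_group_set A).

(** If some [F0] in [H] anticommutes with [E], translation by [F0] permutes [H] and negates the sum,
    which is therefore zero. *)
Lemma sum_sign_perp H E :
  \sum_(F in H) (-1) ^+ (~~ pcommutes E F) = (#|H| * (E \in perp H))%N%:Z.
Proof.
have [/perpP cE | ] := boolP (E \in perp H).
  rewrite (eq_bigr (fun=> 1)) => [|F HF]; last by rewrite cE.
  by rewrite sumr_const muln1 natz.
rewrite inE => /forall_inPn[F0 HF0 /negPf aE]; rewrite muln0.
set s := \sum_(F in H) _; suff : s = - s.
  by move/eqP; rewrite -subr_eq0 opprK -mulr2n mulrn_eq0 => /eqP.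
rewrite {1}/s (reindex_inj (mulgI F0)) -sumrN.
apply: eq_big => [F | F _]; first by rewrite groupMl.
by rewrite pcommutesMr aE signr_addb mulN1r.
Qed.

(* Double counting of the character sum of (-1)^<E,F> over H and all E. *)
Lemma card_perp H : (#|H| * #|perp H|)%N = #|[set: ppauli n]|.
Proof.
apply/eqP; rewrite -eqz_nat; apply/eqP.
transitivity (\sum_(E in [set: ppauli n]) \sum_(F in H) (-1) ^+ (~~ pcommutes E F) : int).
  under eq_bigr do rewrite sum_sign_perp PoszM.
  rewrite PoszM -mulr_sumr; congr (_ * _).
  rewrite (bigID (mem (perp H))) /= [X in _ + X]big1 ?addr0 => [|E /andP[_ /negPf-> //]].
  rewrite (eq_bigr (fun=> 1)) => [|E /andP[_ ->] //]; rewrite sumr_const natz.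
  by apply: (congr1 Posz); apply: eq_card => E; rewrite [in RHS]unfold_in in_setT.
rewrite exchange_big (bigD1 1%g) //= [X in _ + X]big1 => [|F /andP[_ F1]].
  rewrite addr0 (eq_bigr (fun=> 1)) ?sumr_const ?natz // => E _.
  by rewrite pcommutes1.
under eq_bigr do rewrite pcommutesC.
rewrite (sum_sign_perp [group of setT]); case: perpP => [cF|]; last by rewrite muln0.
by case/eqP: F1; apply: pcommutes_nondegenerate => E; apply: cF; rewrite inE.
Qed.

(** One inclusion is symmetry of the form; [card_perp], applied to [H] and to [perp H], makes the
    orders equal. *)
Lemma perpK H : perp (perp H) = H.
Proof.
apply/esym/eqP; rewrite eqEcard; apply/andP; split.
  apply/subsetP=> E HE; apply/perpP=> F /perpP HF; rewrite pcommutesC.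
  exact: HF.
rewrite -(leq_pmul2l (cardG_gt0 (perp_group H))) card_perp.
by rewrite mulnC (card_perp H).
Qed.

Lemma card_ppauli_ge : (4 ^ n <= #|[set: ppauli n]|)%N.
Proof.
rewrite cardsT -[n in (4 ^ n)%N]card_ord.
have <- : #|{: letter}| = 4%N.
  have -> : #|{: letter}| = #|{: bool * bool}|.
    apply: (bij_eq_card (f := letter_code)); exists letter_decode; first exact: letter_codeK.
    by case=> [[] []].
  by rewrite card_prod card_bool.
rewrite -card_ffun.
apply: (@leq_card _ _ (fun w => coset (phases n) (Pauli 0 w))) => w w'.
by move/(congr1 (fun E => letters (repr E))); rewrite !letters_repr_coset.
Qed.

(** * Cutting errors by support, and splitting subgroups by a generator *)

Lemma exists_subset_card (I : finType) (A : {set I}) m :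
  (m <= #|A|)%N -> exists2 B : {set I}, B \subset A & #|B| = m.
Proof.
move=> mA; exists [set j in take m (enum A)].
  by apply/subsetP=> j; rewrite inE => /mem_take; rewrite mem_enum.
rewrite cardsE (card_uniqP _) ?take_uniq ?enum_uniq // size_takel //.
by rewrite -cardE.
Qed.

(** [F] keeps the letters of [E] on [m] positions of its support, [T] those on the complement. *)
Lemma ppauli_split E m : (m <= wt E)%N ->
  exists F T, [/\ E = (F * T)%g, wt F = m & wt T = (wt E - m)%N].
Proof.
case/exists_subset_card=> B BE cB.
pose cut (A : {set 'I_n}) :=
  coset (phases n) (Pauli 0 [ffun j => if j \in A then letters (repr E) j else pI]).
have wt_cut A : wt (cut A) = #|[set j | letters (repr E) j != pI] :&: A|.
  rewrite wt_coset; apply: eq_card => j; rewrite !inE ffunE.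
  by case: (j \in A); rewrite ?andbT ?andbF ?eqxx.
exists (cut B), (cut (~: B)); split.
- apply: letters_repr_inj; apply/ffunP=> j; rewrite letters_reprM !letters_repr_coset.
  by rewrite !ffunE inE; case: (j \in B); case: (letters _ _).
- by rewrite wt_cut (setIidPr BE).
- by rewrite wt_cut -setDE cardsDS // cB.
Qed.

Lemma min_wt_subset (A B : {set ppauli n}) : A \subset B -> (min_wt B <= min_wt A)%N.
Proof.
move=> AB; have [->|/min_wt_attained[E AE <-]] := eqVneq A set0; last first.
  exact: min_wt_le (subsetP AB E AE).
(* For empty [A] the minimum is the default [n.+1], which bounds every [min_wt]. *)
rewrite [leqRHS]big_set0 /min_wt.
by apply: (big_ind (fun m => m <= n.+1)%N) => // [x y hx _|E _];
  rewrite ?geq_min ?hx // geq_minl || exact: leq_trans (wt_le E) _.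
Qed.

Lemma set1_mulG_group (g : ppauli n) H :
  exists H' : {group ppauli n}, H' = ([set 1; g] * H)%g :> {set ppauli n}.
Proof.
have g2 : group_set [set 1%g; g].
  apply/group_setP; split=> [|E F]; rewrite !inE ?eqxx //.
  by move=> /orP[]/eqP-> /orP[]/eqP->; rewrite ?mulg1 ?mul1g ?ppauli_sq ?eqxx ?orbT.
have /comm_group_setP gH : commute (Group g2) H.
  by apply/setP=> T; apply/mulsgP/mulsgP=> -[E F AE AF ->]; exists F E => //; rewrite ppauliC.
by exists (Group gH).
Qed.

(** Pick [F] anticommuting with some [g] in [H], and let [H1] be the kernel on [H] of the character
    given by [F]. An element of [H] outside [H1] enters it after multiplication by [g]. *)
Lemma exists_index2 H : (1 < #|H|)%N ->
  exists2 g, g \in H & exists2 H1 : {group ppauli n}, H1 \proper H &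
    H = ([set 1; g] * H1)%g :> {set ppauli n}.
Proof.
rewrite cardG_gt1 => /trivgPn[g Hg g1].
have [F gF] : exists F, ~~ pcommutes g F.
  apply/existsP; apply: contraR g1 => /existsPn cg.
  by apply/eqP/pcommutes_nondegenerate => F; apply: negbNE.
pose H1 := (H :&: perp [set F])%G.
have perp1 E : (E \in perp [set F]) = pcommutes E F.
  apply/perpP/idP => [cE | cE T]; first by apply: cE; rewrite inE.
  by rewrite inE => /eqP->.
have inH1 E : (E \in H1) = (E \in H) && pcommutes E F by rewrite in_setI perp1.
exists g => //; exists H1.
  rewrite properE subsetIl; apply/subsetPn; exists g => //.
  by rewrite inH1 (negPf gF) andbF.
apply/eqP; rewrite eqEsubset; apply/andP; split; apply/subsetP=> E.
  move=> HE; have [cE|aE] := boolP (pcommutes E F).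
    by rewrite -[E]mul1g mem_mulg ?set21 // inH1 HE.
  rewrite -[E]mul1g -(ppauli_sq g) -mulgA mem_mulg ?set22 // inH1 groupM //=.
  by apply: negbNE; rewrite pcommutesMl gF aE.
case/mulsgP=> x y /set2P[]->; rewrite inH1 => /andP[Hy _] ->; rewrite ?mul1g //.
by rewrite groupM.
Qed.

End ProjectivePauli.

(** * Syndromes, logical operators and uncorrectable errors *)

Section StabilizerErrors.
Variables (n k : nat) (S L : {group pauli n}) (D : sdual S -> ppauli n).
Hypotheses (hk : (1 <= k <= n)%N) (hS : stabilizer_code k S).
Hypotheses (hL : logical_group S L) (hD : decoding_map D).
Implicit Types (E F : ppauli n).
Local Notation piS := (S / phases n)%g.

(** The syndrome is additive and every class is its own inverse, so [E * F] is the difference of the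
    two errors. *)
Lemma syn_eq E F : (syn S E == syn S F) = ((E * F)%g \in perp piS).
Proof.
apply/eqP/perpP => [eEF T /quotient_repr[s Ss ->]|cEF].
  have := congr1 (fun f : sdual S => f (subg S s)) eEF.
  rewrite -{1}[E]coset_reprK -{1}[F]coset_reprK !syn_coset subgK //.
  rewrite !anticommutesNE -!pcommutes_coset !coset_reprK => e.
  apply: negbNE; rewrite pcommutesMl.
  by move: e; do 2!case: (pcommutes _ _).
apply/val_inj/ffunP=> s.
have := cEF _ (mem_coset_quotient (subgP s)).
move/(congr1 negb); rewrite pcommutesMl.
rewrite -[E]coset_reprK -[F]coset_reprK.
move: (syn_coset (repr E) s) (syn_coset (repr F) s) => /= -> ->.
by rewrite !anticommutesNE !pcommutes_coset; do 2!case: (commutes _ _).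
Qed.

Lemma syn1 : syn S 1%g = sdual0 S.
Proof.
apply/val_inj/ffunP=> s; rewrite !ffunE anticommutesNE -pcommutes_coset coset_reprK.
by rewrite pcommutesC pcommutes1.
Qed.

Lemma syn_eq0 E : (syn S E == sdual0 S) = (E \in perp piS).
Proof. by rewrite -syn1 syn_eq mulg1. Qed.

Lemma quotient_cent : ('C(S) / phases n)%g = perp piS :> {set ppauli n}.
Proof.
apply/setP=> E; apply/idP/perpP => [/quotient_repr[P /centP cP ->] _ /quotient_repr[s Ss ->]|cE].
  by rewrite pcommutes_coset; apply/eqP; apply: cP.
rewrite -[E]coset_reprK; apply: mem_coset_quotient; apply/centP=> s Ss.
have := cE _ (mem_coset_quotient Ss).
by rewrite -{1}[E]coset_reprK pcommutes_coset => /eqP.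
Qed.

Lemma quotient_mul_logical : ((S * L) / phases n)%g = perp piS :> {set ppauli n}.
Proof. by have [_ <- _] := hL; rewrite quotient_cent. Qed.

Lemma stabilizer_sub_perp : piS \subset perp piS.
Proof.
rewrite -quotient_mul_logical; apply: morphimS; exact: mulG_subl.
Qed.

(** Otherwise both [piS] and [perp piS] have order at most 2^(n-k), while their orders multiply to
    at least 4^n; this contradicts k >= 1. *)
Lemma logical_exists : exists E, E \in perp piS :\: piS.
Proof.
apply/set0Pn; rewrite setD_eq0; apply/negP => /subset_leq_card le_perp.
have le_piS : (#|piS| <= 2 ^ (n - k))%N by have [<- _] := hS; apply: leq_morphim.
have : (2 ^ (2 * n) <= #|piS| * #|perp piS|)%N.
  by rewrite (card_perp [group of piS]) expnM card_ppauli_ge.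
apply/negP; rewrite -ltnNge.
apply: (@leq_ltn_trans (2 ^ (n - k) * 2 ^ (n - k))).
  by apply: leq_mul => //; apply: leq_trans le_perp _.
by rewrite -expnD ltn_exp2l //; lia.
Qed.

Lemma bad_syn0 E : E \in perp piS -> (E \notin correctable D) = (E \notin piS).
Proof.
by rewrite -syn_eq0 inE => /eqP->; have [-> _] := hD; rewrite mul1g.
Qed.

Lemma one_correctable : 1%g \in correctable D.
Proof.
apply: negbNE; rewrite bad_syn0 ?negbK ?group1 //.
Qed.

(** Both errors share the recovery [D (syn S E)], which cancels in the product because it squares to
    1. *)
Lemma correctable_same_syn E F : syn S E = syn S F ->
  E \in correctable D -> F \in correctable D -> (E * F)%g \in piS.
Proof.
rewrite !inE => -> DE DF; have := groupM DE DF.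
by rewrite (ppauliC (D _)) -mulgA (mulgA (D _)) ppauli_sq mul1g.
Qed.

Lemma min_wt_bad_le_half_distance :
  (min_wt (~: correctable D) <= uphalf (distance S L))%N.
Proof.
rewrite /distance quotient_mul_logical.
have [|T] := @min_wt_attained _ (perp piS :\: piS); first exact/set0Pn/logical_exists.
rewrite inE => /andP[T_S T_perp] wT.
have le_half : ((wt T)./2 <= wt T)%N by rewrite -[leqRHS]odd_double_half -addnn; lia.
(* [E] gets the rounded-down half of the weight and [F] the rounded-up half, so either being
   uncorrectable gives the bound. *)
have [E [F [eT wE wF]]] := ppauli_split le_half.
have eEF : syn S E = syn S F by apply/eqP; rewrite syn_eq -eT.
rewrite -wT; have [cE|bE] := boolP (E \in correctable D); last first.
  apply: leq_trans (min_wt_le (E := E) _) _; first by rewrite inE.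
  by rewrite wE; lia.
have [cF|bF] := boolP (F \in correctable D).
  by case/negP: T_S; rewrite eT; apply: correctable_same_syn.
apply: leq_trans (min_wt_le (E := F) _) _; first by rewrite inE.
by rewrite wF; lia.
Qed.

(** An uncorrectable error of zero syndrome is a nontrivial logical operator, hence has weight at
    least the distance. *)
Lemma bad_syn_neq0 E : E \in ~: correctable D -> (wt E < distance S L)%N ->
  syn S E != sdual0 S.
Proof.
rewrite inE /distance quotient_mul_logical => bE; apply: contraTneq => /eqP.
rewrite syn_eq0 => pE; rewrite -leqNgt; apply: min_wt_le.
by rewrite inE pE -bad_syn0 // bE.
Qed.

(** Commuting with both factors means commuting with pi(SL), which is [perp piS]; [perpK] then
    returns [piS]. *)
Lemma perp_logical : perp (L / phases n)%g :&: perp piS = piS.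
Proof.
apply/eqP; rewrite eqEsubset subsetI stabilizer_sub_perp andbT; apply/andP; split.
  apply/subsetP=> E; rewrite inE => /andP[/perpP EL /perpP ES].
  rewrite -[X in _ \in pred_of_set X](perpK [group of piS]).
  apply/perpP=> T; rewrite -quotient_mul_logical.
  case/quotient_repr=> _ /mulsgP[s l Ss Ll ->] ->; rewrite cosetM.
  have := pcommutesMr E (coset _ s) (coset _ l).
  rewrite (EL (coset _ l)) ?(ES (coset _ s)) ?mem_coset_quotient //.
  by move/negbFE.
have [LC _ _] := hL; apply/subsetP=> E SE; apply/perpP=> F /(subsetP (morphimS _ LC)).
by rewrite -/(quotient _ _) quotient_cent pcommutesC => /perpP; apply.
Qed.

End StabilizerErrors.

(** * Fidelities as ratios of error masses, compared for small p *)

Section Fidelity.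
Variables (R : realType) (n : nat) (S : {group pauli n}).
Variables (D : sdual S -> ppauli n) (G : {group ppauli n}).
Hypothesis hD : decoding_map D.
Implicit Types (E F : ppauli n) (A : {set ppauli n}) (p pDD m : R).

(** Recovery is deterministically [D sigma], also at zero syndrome since D(0) = 1, so exactly the
    correctable errors succeed. *)
Lemma F_hyb_noiseless_recovery p pDD : F_hyb D G p pDD 0 =
  (\sum_(E in correctable D) ldd_weight G p pDD E) / \sum_E ldd_weight G p pDD E.
Proof.
have recE sigma Q : recovery_prob D (0 : R) sigma Q = (Q == D sigma)%:R.
  rewrite /recovery_prob subr0 mul1r mul0r addr0.
  by case: eqP => // ->; have [-> _] := hD.
rewrite /F_hyb mulr_suml [RHS]big_mkcond /=; apply: eq_bigr => E _.
under eq_bigr do rewrite recE.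
rewrite -/(error_prob G p pDD E) inE big_mkcond /= (bigD1 (D (syn S E))) //= eqxx.
rewrite big1 ?addr0 => [|Q /negPf->]; last by case: ifP.
by case: ifP; rewrite ?mulr1 ?mulr0.
Qed.

Lemma ldd_weight_sum A p pDD : \sum_(E in A) ldd_weight G p pDD E =
  \sum_(E in A :\: suppressed G) depol p E
  + pDD * \sum_(E in A :&: suppressed G) depol p E.
Proof.
rewrite (bigID (mem (suppressed G))) /= addrC mulr_sumr; congr (_ + _).
  apply: eq_big => [E|E /andP[_ /negPf sE]]; first by rewrite in_setD andbC.
  by rewrite /ldd_weight sE mul1r.
by apply: eq_big => [E|E /andP[_ sE]]; rewrite ?in_setI // /ldd_weight sE.
Qed.

Lemma depol_ge0 p E : 0 <= p <= 1 -> 0 <= depol p E.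
Proof. by move=> p01; rewrite /depol mulr_ge0 ?exprn_ge0 //; lra. Qed.

(** Raising the weight trades factors [u] for smaller factors [v]; used with u = 1 - p and v = p/3,
    where p/3 <= 1 - p. *)
Lemma weight_antitone (u v : R) (i j : nat) : 0 <= v <= u -> (i <= j <= n)%N ->
  u ^+ (n - j) * v ^+ j <= u ^+ (n - i) * v ^+ i.
Proof.
move=> /andP[v0 vu] /andP[ij jn]; have u0 := le_trans v0 vu.
have -> : (n - i = (n - j) + (j - i))%N by lia.
rewrite -[X in _ * v ^+ X <= _](subnK ij) !exprD mulrA ler_wpM2r ?exprn_ge0 //.
by rewrite ler_wpM2l ?exprn_ge0 // lerXn2r ?nnegrE.
Qed.

Lemma sum_depol_le p m A : 0 <= m -> {in A, forall E, depol p E <= m} ->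
  \sum_(E in A) depol p E <= #|[set: ppauli n]|%:R * m.
Proof.
move=> m0 Am; apply: le_trans (ler_sum _ Am) _.
rewrite sumr_const -[leLHS]mulr_natl ler_wpM2r // ler_nat.
by rewrite subset_leq_card ?subsetT.
Qed.

Lemma depol_le_sum p A E : 0 <= p <= 1 -> E \in A ->
  depol p E <= \sum_(F in A) depol p F.
Proof.
move=> p01 AE; rewrite (bigD1 E) //= lerDl.
by apply: sumr_ge0 => F _; apply: depol_ge0.
Qed.

(* a + b and c + e are the correctable and uncorrectable masses, of which b and
   e are suppressed. *)
Lemma rescaled_fraction_lt (a b c e x : R) :
  0 < a -> 0 <= b -> 0 <= c -> 0 <= e -> 0 <= x < 1 -> b * c < a * e ->
  (a + b) / (a + b + (c + e)) < (a + x * b) / (a + x * b + (c + x * e)).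
Proof.
move=> a0 b0 c0 e0 /andP[x0 x1] bc.
have xb : 0 <= x * b by rewrite mulr_ge0.
have xe : 0 <= x * e by rewrite mulr_ge0.
rewrite ltr_pdivrMr; last by lra.
rewrite mulrAC ltr_pdivlMr; last by lra.
rewrite -subr_gt0; have -> : (a + x * b) * (a + b + (c + e)) -
  (a + b) * (a + x * b + (c + x * e)) = (1 - x) * (a * e - b * c) by ring.
by rewrite mulr_gt0 // subr_gt0.
Qed.

Lemma F_hyb_gt_qec (pDD : R) E0 :
  0 <= pDD < 1 -> (0 < n)%N ->
  E0 \in suppressed G :&: ~: correctable D ->
  wt E0 = min_wt (~: correctable D) ->
  exists2 p0 : R, 0 < p0 <= 1 &
    forall p : R, 0 < p < p0 -> F_qec D G p 0 < F_hyb D G p pDD 0.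
Proof.
move=> hDD n0 E0in wE0.
set K := correctable D in E0in wE0.
have K1 : 1%g \in K := one_correctable hD.
set N : R := #|[set: ppauli n]|%:R.
have N1 : 1 <= N.
  by rewrite ler1n; apply/card_gt0P; exists 1%g; rewrite inE.
have NN : 1 <= N * N by rewrite -[1]mulr1 ler_pM.
(* Below this threshold p N^2 < 1 - p, which absorbs the factor N lost in each of the bounds [hb]
   and [hc]. *)
exists ((N * N + 1)^-1).
  by rewrite invr_gt0 invf_le1; lra.
move=> p /andP[p0 pN].
have {}pN : p * (N * N) + p < 1.
  by move: pN; rewrite -[X in p < X]mul1r ltr_pdivlMr; [rewrite mulrDr mulr1 | lra].
have pp : p <= p * (N * N) by rewrite ler_peMr // ltW.
have p01 : 0 <= p <= 1 by lra.
have u0 : 0 < 1 - p by lra.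
have vu : 0 <= p / 3%:R <= 1 - p by lra.
pose q i := (1 - p) ^+ (n - i) * (p / 3%:R) ^+ i.
have qE E : depol p E = q (wt E) by [].
have q0 i : 0 <= q i by rewrite mulr_ge0 ?exprn_ge0 //; lra.
have q_gt0 i : 0 < q i by rewrite mulr_gt0 ?exprn_gt0 //; lra.
have q_anti (E : ppauli n) i : (i <= wt E)%N -> depol p E <= q i.
  by move=> iE; apply: weight_antitone; rewrite ?iE ?wt_le.
set al := min_wt _ in wE0.
have ha : q 0%N <= \sum_(E in K :\: suppressed G) depol p E.
  rewrite -(wt1 n) -qE; apply: depol_le_sum => //.
  by rewrite in_setD K1 andbT inE negbK; exact: (group1 (perp_group G)).
have he : q al <= \sum_(E in ~: K :&: suppressed G) depol p E.
  by rewrite -wE0 -qE; apply: depol_le_sum => //; rewrite setIC.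
have hb : \sum_(E in K :&: suppressed G) depol p E <= N * q 1%N.
  apply: sum_depol_le => // E; rewrite in_setI => /andP[_ sE].
  apply: q_anti; apply: wt_gt0; apply: contraTneq sE => ->.
  by rewrite inE negbK; exact: (group1 (perp_group G)).
have hc : \sum_(E in ~: K :\: suppressed G) depol p E <= N * q al.
  apply: sum_depol_le => // E; rewrite in_setD => /andP[_ bE].
  by apply: q_anti; apply: min_wt_le.
(* After removing the common factor (1 - p)^(n-1) this reads N^2 p/3 < 1 - p. *)
have q10 : N * N * q 1%N < q 0%N.
  rewrite /q subn0 expr0 mulr1 expr1 -[in X in _ < X](subnK n0) exprD expr1.
  rewrite mulrCA ltr_pM2l ?exprn_gt0 //; lra.
rewrite /F_qec !F_hyb_noiseless_recovery.
have sum_split x : \sum_E ldd_weight G p x E =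
    \sum_(E in K) ldd_weight G p x E + \sum_(E in ~: K) ldd_weight G p x E.
  rewrite (bigID (mem K)) /=; congr (_ + _).
  by apply: eq_bigl => E; rewrite in_setC.
rewrite !sum_split !ldd_weight_sum !mul1r.
have sum_ge0 A : 0 <= \sum_(E in A) depol p E.
  by apply: sumr_ge0 => E _; apply: depol_ge0.
apply: rescaled_fraction_lt => //; first exact: lt_le_trans (q_gt0 0%N) ha.
apply: (@le_lt_trans _ _ ((N * q 1%N) * (N * q al))); first exact: ler_pM.
apply: (@lt_le_trans _ _ (q 0%N * q al)); last exact: ler_pM.
by rewrite mulrACA mulrA ltr_pM2r.
Qed.

End Fidelity.

(** * Derivation of the four claims *)

Theorem theorem3 (R : realType) (n k : nat)
    (S L : {group pauli n}) (D : sdual S -> ppauli n)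
    (G : {group ppauli n}) (pDD pQEC : R)
    (hk : (1 <= k <= n)%N)
    (hS : stabilizer_code k S)
    (hL : logical_group S L)
    (hD : decoding_map D)
    (hG : (1 < #|G|)%N)
    (hQEC : pQEC = 0)
    (hDD : 0 <= pDD < 1) :
  let bad := ~: correctable D in
  let alpha := min_wt bad in
  let beta (H : {set ppauli n}) := min_wt (suppressed H :&: bad) in
  [/\ (alpha <= beta G)%N,
      (* 1 *)
      beta G = alpha ->
      exists2 p0 : R, 0 < p0 <= 1 &
        forall p : R, 0 < p < p0 -> F_qec D G p pQEC < F_hyb D G p pDD pQEC,
      (* 2 *)
      (exists2 g, g \in G &
         exists2 G1 : {group ppauli n}, G1 \proper G &
           G = ([set 1%g; g] * G1)%g :> {set ppauli n}) /\
      ((alpha < beta G)%N ->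
       (exists E, [/\ E \in bad, wt E = alpha & syn S E != sdual0 S]) ->
       forall (g : ppauli n) (G1 : {group ppauli n}),
         g \in G -> G1 \proper G ->
         G = ([set 1%g; g] * G1)%g :> {set ppauli n} ->
         exists2 s, s \in (S / phases n)%g &
           exists G' : {group ppauli n},
             [/\ G' = ([set 1%g; (g * s)%g] * G1)%g :> {set ppauli n},
                 (1 < #|G'|)%N & beta G' = alpha]),
      (* 3 *)
      (2 <= distance S L)%N ->
      (alpha <= uphalf (distance S L) < distance S L)%N /\
      (forall E, E \in bad -> wt E = alpha -> syn S E != sdual0 S) &
      (* 4 *)
      (alpha < beta G)%N -> G = (L / phases n)%g :> {set ppauli n} ->
      forall E, E \in bad -> wt E = alpha -> syn S E != sdual0 S].
Proof.
move=> bad alpha beta.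
have [E0 E0perp] := logical_exists hk hS.
have bad_n0 : bad != set0.
  apply/set0Pn; exists E0; move: E0perp; rewrite !in_setD in_setC => /andP[E0S pE0].
  by rewrite (bad_syn0 hD pE0).
have alpha_le H : (alpha <= beta H)%N by apply/min_wt_subset/subsetIr.
have wt_alpha_perp E : (alpha < beta G)%N -> E \in bad -> wt E = alpha -> E \in perp G.
  move=> lt_ab bE wE; move: lt_ab; apply: contraTT => sE; rewrite -leqNgt -wE.
  by apply: min_wt_le; rewrite in_setI bE andbT in_setC.
split=> //.
- move=> eq_ab; have [E bE wE] := min_wt_attained bad_n0.
  have beta_n0 : suppressed G :&: bad != set0.
    (* If no uncorrectable error were suppressed, [beta G] would be the default [n.+1], exceeding
       the weight of [E]. *)
    apply: contraTneq (wt_le E) => b0; rewrite -ltnNge wE -/alpha -eq_ab.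
    by rewrite /beta b0 /min_wt big_set0.
  have [F bF wF] := min_wt_attained beta_n0.
  rewrite hQEC; apply: (F_hyb_gt_qec hD hDD _ bF); first by lia.
  by rewrite wF -/(beta G) eq_ab.
- split; first exact: exists_index2.
  move=> lt_ab [E [bE wE synE]] g G1 Gg _ defG.
  have := synE; rewrite syn_eq0 inE => /forall_inPn[s Ss aEs].
  exists s => //; have [G' defG'] := set1_mulG_group (g * s) G1.
  have cEg : pcommutes E g by move/perpP: (wt_alpha_perp E lt_ab bE wE); apply.
  have aEgs : ~~ pcommutes E (g * s)%g by rewrite pcommutesMr cEg aEs.
  (* This element anticommutes with [E], so it shows both that [G'] is nontrivial and that [G']
     suppresses [E], whose weight is [alpha]. *)
  have gsG' : (g * s)%g \in (G' : {set _}).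
    by rewrite defG' -[(g * s)%g]mulg1 mem_mulg ?group1 // mulg1 set22.
  exists G'; split=> //.
    rewrite cardG_gt1; apply/trivgPn; exists (g * s)%g => //.
    by apply: contraNneq aEgs => ->; apply: pcommutes1.
  apply/eqP; rewrite eqn_leq alpha_le andbT -wE; apply: min_wt_le.
  rewrite in_setI bE andbT in_setC; apply: contra aEgs => /perpP; exact.
- move=> d2; have half := min_wt_bad_le_half_distance D hk hS hL.
  have half_lt : (uphalf (distance S L) < distance S L)%N by lia.
  split; first by rewrite half half_lt.
  move=> E bE wE; apply: (bad_syn_neq0 hL hD bE).
  by rewrite wE; apply: leq_ltn_trans half half_lt.
- move=> lt_ab defG E bE wE; rewrite syn_eq0; apply/negP => pE.
  have := wt_alpha_perp E lt_ab bE wE; rewrite defG => EL.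
  have := bE; rewrite in_setC (bad_syn0 hD pE).
  by rewrite -(perp_logical hL) in_setI EL pE.
Qed.
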